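(* Let $\Sigma: x^+=Ax+Bu+Ew$ be a discrete-time linear system with $A$ nilpotent, and let the safe set $S_{xu}\subset\mathbb{R}^n\times\mathbb{R}^m$ and the disturbance set $W\subset\mathbb{R}^d$ be polytopes. For $q\in\mathbb{N}$ let $\Theta_q=\{(\tau,\lambda)\in(\mathbb{N}\cup\{0\})\times\mathbb{N}\mid\tau+\lambda=q\}$, and define $$\mathcal{C}_{xv,q}=\bigcup_{(\tau,\lambda)\in\Theta_q}\mathcal{C}_{xv,(\tau,\lambda)}\subset\mathbb{R}^n\times\mathbb{R}^{mq},\qquad \mathcal{C}_{x,q}=\pi_n(\mathcal{C}_{xv,q})=\bigcup_{(\tau,\lambda)\in\Theta_q}\pi_n(\mathcal{C}_{xv,(\tau,\lambda)}),$$ where $\mathcal{C}_{xv,(\tau,\lambda)}$ is the closed-form set associated with the $(\tau,\lambda)$-lasso matrices. Then for every $q\in\mathbb{N}$, $\mathcal{C}_{xv,q}$ is an implicit RCIS for $\Sigma$ within $S_{xu}$ (so $\mathcal{C}_{x,q}$ is an RCIS for $\Sigma$ within $S_{xu}$), and $$\mathcal{C}_{x,q}\supseteq\mathcal{C}_{x,q'}\quad\text{for all }q,q'\in\mathbb{N}\text{ with }q'<q.$$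
   Context: Setting: $x\in\mathbb{R}^n$ is the state, $u\in\mathbb{R}^m$ the input, $w\in W$ the disturbance; $A\in\mathbb{R}^{n\times n}$, $B\in\mathbb{R}^{n\times m}$, $E\in\mathbb{R}^{n\times d}$. $\mathbb{N}$ denotes the positive integers. $\nu\in\mathbb{N}$ is the smallest positive integer with $A^\nu=0$. A polytope is a bounded set of the form $\{z\mid Gz\le f\}$. Sets: sums of sets are Minkowski sums; $Q-P=\{z\mid z+p\in Q\ \forall p\in P\}$ is the Minkowski difference. $\overline{W}_t=\sum_{i=1}^tA^{i-1}EW$ (with $\overline{W}_0=\{0\}$) and $\overline{W}_\infty=\sum_{i=1}^{\nu}A^{i-1}EW$. $\pi_n$ is the projection onto the first $n$ coordinates. RCIS: $\mathcal{C}\subseteq\pi_n(S_{xu})$ is a robust controlled invariant set (RCIS) for $\Sigma$ within $S_{xu}$ if for every $x\in\mathcal{C}$ there is $u\in\mathbb{R}^m$ with $(x,u)\in S_{xu}$ and $Ax+Bu+EW\subseteq\mathcal{C}$. A set in $\mathbb{R}^n\times\mathbb{R}^p$ (for some $p\in\mathbb{N}$) is an implicit RCIS for $\Sigma$ within $S_{xu}$ if its projection under $\pi_n$ is an RCIS for $\Sigma$ within $S_{xu}$. $(\tau,\lambda)$-lasso matrices: for $\tau\in\mathbb{N}\cup\{0\}$, $\lambda\in\mathbb{N}$, $q=\tau+\lambda$, let $P_{(\tau,\lambda)}=\mathrm{blkdiag}(\bar P,\dots,\bar P)\in\mathbb{R}^{mq\times mq}$ and $H_{(\tau,\lambda)}=\mathrm{blkdiag}(\bar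 H,\dots,\bar H)\in\mathbb{R}^{m\times mq}$, with $m$ blocks each, where $\bar H=[1\ 0\ \cdots\ 0]\in\mathbb{R}^{1\times q}$ and $\bar P\in\mathbb{R}^{q\times q}$ has first $q-1$ rows $[\,0\ \ I_{q-1}]$ and last row with a single entry $1$ at position $\tau+1$ (positions counted from 1) and zeros elsewhere. Closed-form set: with $P=P_{(\tau,\lambda)}$, $H=H_{(\tau,\lambda)}$, $\mathcal{C}_{xv,(\tau,\lambda)}$ is the set of $(x,v)\in\mathbb{R}^n\times\mathbb{R}^{mq}$ satisfying $$\Big(A^t x+\sum_{i=1}^{t}A^{i-1}BHP^{t-i}v,\ HP^tv\Big)\in S_{xu}-\overline{W}_t\times\{0\},\quad t=0,\dots,\nu-1,$$ $$\Big(\sum_{i=1}^{\nu}A^{i-1}BHP^{t-i}v,\ HP^tv\Big)\in S_{xu}-\overline{W}_\infty\times\{0\},\quad t=\nu,\dots,\nu+\tau+\lambda-1.$$ *)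

(* Defs.v *)
From mathcomp Require Import all_boot all_order all_algebra.
From mathcomp Require Import all_classical all_reals all_analysis.
From mathcomp.real_closed Require Import mxtens.

Set Implicit Arguments.
Unset Strict Implicit.
Unset Printing Implicit Defensive.

Import Order.TTheory GRing.Theory Num.Theory.
Import numFieldNormedType.Exports.

Local Open Scope classical_set_scope.
Local Open Scope ring_scope.

(* R^n is 'cV[R]_n and R^n x R^p is 'cV[R]_(n + p): the pair (x, y) is
   col_mx x y, and the projection onto the first n coordinates is usubmx. *)

Definition polytope (R : realType) (n : nat) (Z : set 'cV[R]_n) : Prop :=
  bounded_set Z /\
  exists (k : nat) (G : 'M[R]_(k, n)) (f : 'cV[R]_k),
    Z = [set z | forall i, (G *m z) i 0 <= f i 0].

Definition proj_fst (R : realType) (n p : nat) (C : set 'cV[R]_(n + p)) :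
    set 'cV[R]_n :=
  [set usubmx z | z in C].

Definition minkowski_sum (R : realType) (n : nat) (P Q : set 'cV[R]_n) :
    set 'cV[R]_n :=
  [set p + q | p in P & q in Q].

Definition minkowski_diff (R : realType) (n : nat) (Q P : set 'cV[R]_n) :
    set 'cV[R]_n :=
  [set z | forall p, P p -> Q (z + p)].

Definition nilpotency_index (R : realType) (n : nat) (A : 'M[R]_n)
    (nu : nat) : Prop :=
  [/\ (0 < nu)%N, A ^+ nu = 0 &
      forall k : nat, (0 < k)%N -> A ^+ k = 0 -> (nu <= k)%N].

Definition RCIS (R : realType) (n m d : nat) (A : 'M[R]_n) (B : 'M[R]_(n, m))
    (E : 'M[R]_(n, d)) (W : set 'cV[R]_d) (Sxu : set 'cV[R]_(n + m))
    (C : set 'cV[R]_n) : Prop :=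
  C `<=` proj_fst Sxu /\
  forall x, C x ->
    exists u : 'cV[R]_m, Sxu (col_mx x u) /\
      minkowski_sum [set A *m x + B *m u] [set E *m w | w in W] `<=` C.

Definition implicit_RCIS (R : realType) (n m d p : nat) (A : 'M[R]_n)
    (B : 'M[R]_(n, m)) (E : 'M[R]_(n, d)) (W : set 'cV[R]_d)
    (Sxu : set 'cV[R]_(n + m)) (C : set 'cV[R]_(n + p)) : Prop :=
  RCIS A B E W Sxu (proj_fst C).

Definition Wbar (R : realType) (n d : nat) (A : 'M[R]_n) (E : 'M[R]_(n, d))
    (W : set 'cV[R]_d) (t : nat) : set 'cV[R]_n :=
  \big[@minkowski_sum R n / [set 0]]_(1 <= i < t.+1)
    [set A ^+ i.-1 *m E *m w | w in W].

Definition Wbar_infty (R : realType) (n d : nat) (A : 'M[R]_n)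
    (E : 'M[R]_(n, d)) (W : set 'cV[R]_d) (nu : nat) : set 'cV[R]_n :=
  Wbar A E W nu.

Definition times_zero (R : realType) (n m : nat) (Y : set 'cV[R]_n) :
    set 'cV[R]_(n + m) :=
  [set col_mx y 0 | y in Y].

(* The Kronecker product of 1%:M : 'M_m and M is blkdiag(M, ..., M) with m
   blocks. *)
Definition blkdiag (R : realType) (m p q : nat) (M : 'M[R]_(p, q)) :
    'M[R]_(m * p, m * q) :=
  (1%:M : 'M[R]_m) *t M.

(* The (tau, lambda)-lasso matrices. Their size q = tau + lambda is a separate
   argument, so that all pairs (tau, lambda) in Theta q give matrices of the
   same type; lambda is then determined by q and tau. Indices start from 0, so
   that position tau + 1 of the last row is column tau. *)
Definition lasso_Pbar (R : realType) (q tau : nat) : 'M[R]_q :=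
  \matrix_(i < q, j < q)
    (if (i.+1 < q)%N then (j == i.+1 :> nat)%:R else (j == tau :> nat)%:R).

Definition lasso_Hbar (R : realType) (q : nat) : 'rV[R]_q :=
  \row_(j < q) (j == 0%N :> nat)%:R.

Definition lasso_P (R : realType) (m q tau : nat) : 'M[R]_(m * q) :=
  blkdiag m (lasso_Pbar R q tau).

Definition lasso_H (R : realType) (m q : nat) : 'M[R]_(m, m * q) :=
  castmx (muln1 m, erefl (m * q)%N) (blkdiag m (lasso_Hbar R q)).

(* To be used with (tau, lambda) in Theta q; see lasso_Pbar for q. *)
Definition Cxv_lasso (R : realType) (n m d : nat) (A : 'M[R]_n)
    (B : 'M[R]_(n, m)) (E : 'M[R]_(n, d)) (W : set 'cV[R]_d)
    (Sxu : set 'cV[R]_(n + m)) (nu q tau lambda : nat) :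
    set 'cV[R]_(n + m * q) :=
  let P := lasso_P R m q tau in
  let H := lasso_H R m q in
  [set z : 'cV[R]_(n + m * q) | let x := usubmx z in let v := dsubmx z in
    (forall t : nat, (t <= nu.-1)%N ->
       minkowski_diff Sxu (times_zero (Wbar A E W t))
         (col_mx (A ^+ t *m x +
                  \sum_(1 <= i < t.+1)
                    A ^+ i.-1 *m B *m H *m P ^+ (t - i) *m v)
                 (H *m P ^+ t *m v))) /\
    (forall t : nat, (nu <= t <= (nu + tau + lambda).-1)%N ->
       minkowski_diff Sxu (times_zero (Wbar_infty A E W nu))
         (col_mx (\sum_(1 <= i < nu.+1)
                    A ^+ i.-1 *m B *m H *m P ^+ (t - i) *m v)
                 (H *m P ^+ t *m v)))].

Arguments Cxv_lasso {R n m d} A B E W Sxu nu q tau lambda _.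

Definition Theta (q : nat) : set (nat * nat) :=
  [set tl | (0 < tl.2)%N /\ (tl.1 + tl.2)%N = q].

Definition Cxv (R : realType) (n m d : nat) (A : 'M[R]_n)
    (B : 'M[R]_(n, m)) (E : 'M[R]_(n, d)) (W : set 'cV[R]_d)
    (Sxu : set 'cV[R]_(n + m)) (nu q : nat) : set 'cV[R]_(n + m * q) :=
  \bigcup_(tl in Theta q) Cxv_lasso A B E W Sxu nu q tl.1 tl.2.

Arguments Cxv {R n m d} A B E W Sxu nu q _.

Definition Cx (R : realType) (n m d : nat) (A : 'M[R]_n)
    (B : 'M[R]_(n, m)) (E : 'M[R]_(n, d)) (W : set 'cV[R]_d)
    (Sxu : set 'cV[R]_(n + m)) (nu q : nat) : set 'cV[R]_n :=
  proj_fst (Cxv A B E W Sxu nu q).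

(* Main.v *)
Require Import Defs.
From mathcomp Require Import all_boot all_order all_algebra.
From mathcomp Require Import all_classical all_reals all_analysis.
From mathcomp.real_closed Require Import mxtens.
From HB Require Import structures.
From mathcomp Require Import ssrAC zify.

Import Order.TTheory GRing.Theory Num.Theory.
Import numFieldNormedType.Exports.
Local Open Scope classical_set_scope.
Local Open Scope ring_scope.

(** The auxiliary vector v is an encoding of an open-loop input sequence: the
    lasso matrices output u_t = H P^t v, and as v varies these are exactly the
    sequences with u_(t + lambda) = u_t for every t >= tau (lasso_input_lasso
    and lasso_input_surj). The closed-form set asks that applying u from x keep
    state and input in the safe set for every disturbance, at the times
    t < nu + tau + lambda.

    From time nu on, nilpotency erases the initial state and every input and
    disturbance older than nu, so the condition at time t only involves the
    inputs u_(t - nu), ..., u_t; once t >= nu + tau these are lambda-periodic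
    and the condition repeats itself. Hence the finite list of conditions is
    equivalent to safety at all times, and proj_Cxv_lassoE describes the
    projection of the closed-form set as the set of x from which some
    (tau, lambda)-lasso input sequence is robustly safe forever.

    In this form both claims are short. Invariance: apply u_0; whatever the
    disturbance, the input sequence shifted by one step is again a
    (tau, lambda)-lasso and is robustly safe from the successor state
    (robustly_safe_shift), since the disturbance just received is one of the
    terms that the longer sum of disturbance sets already allowed for.
    Monotonicity: a (tau, lambda)-lasso is also a (tau + k, lambda)-lasso, and
    robust safety does not mention tau or lambda. *)

(** * Minkowski sums and accumulated disturbances *)

Section MinkowskiSum.
Variables (R : realType) (n : nat).

Lemma minkowski_sumA : associative (@minkowski_sum R n).
Proof.
move=> X Y Z; apply/seteqP; split => z [].
- by move=> x Xx [_ [y Yy [w Zw <-]] <-]; exists (x + y);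
    [exists x => //; exists y | exists w => //; rewrite addrA].
- by move=> _ [x Xx [y Yy <-]] [w Zw <-]; exists x => //;
    exists (y + w); [exists y => //; exists w | rewrite addrA].
Qed.

Lemma minkowski_sumC : commutative (@minkowski_sum R n).
Proof.
by move=> X Y; apply/seteqP; split => z [x Xx [y Yy <-]];
  exists y => //; exists x => //; rewrite addrC.
Qed.

Lemma minkowski_sum0 : left_id [set 0] (@minkowski_sum R n).
Proof.
move=> X; apply/seteqP; split => [z [_ -> [x Xx <-]]|x Xx].
  by rewrite add0r.
by exists 0 => //; exists x => //; rewrite add0r.
Qed.

(* Lets the last summand of Wbar, rather than the first, be split off. *)
HB.instance Definition _ := Monoid.isComLaw.Build (set 'cV[R]_n) [set 0]
  (@minkowski_sum R n) minkowski_sumA minkowski_sumC minkowski_sum0.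

End MinkowskiSum.

Lemma minkowski_diff_times_zero {R : realType} {n m : nat}
    (Q : set 'cV[R]_(n + m)) (Y : set 'cV[R]_n) (x : 'cV[R]_n) (u : 'cV[R]_m) :
  minkowski_diff Q (times_zero Y) (col_mx x u) <->
  forall y, Y y -> Q (col_mx (x + y) u).
Proof.
split=> [h y Yy | h _ [y Yy <-]]; last by rewrite add_col_mx addr0; apply: h.
have /h : @times_zero R n m Y (col_mx y 0) by exists y.
by rewrite add_col_mx addr0.
Qed.

Section Disturbances.
Variables (R : realType) (n d : nat) (A : 'M[R]_n) (E : 'M[R]_(n, d)).
Variable W : set 'cV[R]_d.

Lemma WbarS (t : nat) :
  Wbar A E W t.+1 =
  minkowski_sum (Wbar A E W t) [set A ^+ t *m E *m w | w in W].
Proof. by rewrite /Wbar big_nat_recr. Qed.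

(** The summand added at time t >= nu is {0}, unless W is empty; in that case
    Wbar t is already empty, because t >= nu > 0. *)
Lemma Wbar_nilpotent (nu t : nat) :
  (0 < nu)%N -> A ^+ nu = 0 -> (nu <= t)%N -> Wbar A E W t = Wbar A E W nu.
Proof.
move=> nu0 Anu /subnK <-; elim: (t - nu)%N => // k IH; rewrite addSn WbarS.
have -> : A ^+ (k + nu) = 0 by rewrite exprD Anu mulr0.
rewrite -IH; apply/seteqP; split=> p.
  by case=> p' hp' [_ [w _ <-] <-]; rewrite !mul0mx addr0.
move=> hp; exists p => //; exists 0; last by rewrite addr0.
suff [w Ww] : exists w, W w by exists w => //; rewrite !mul0mx.
move: hp; case: (k + nu)%N (leq_addl k nu) => [|s _].
  by move=> /(leq_trans nu0).
by rewrite WbarS => -[_ _ [_ [w Ww _] _]]; exists w.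
Qed.

End Disturbances.

(** * Robust safety of an input sequence *)

Definition open_loop {R : realType} {n m : nat} (A : 'M[R]_n) (B : 'M[R]_(n, m))
    (x : 'cV[R]_n) (u : nat -> 'cV[R]_m) (t : nat) : 'cV[R]_n :=
  A ^+ t *m x + \sum_(1 <= i < t.+1) A ^+ i.-1 *m B *m u (t - i)%N.

Definition safe_at {R : realType} {n m d : nat} (A : 'M[R]_n)
    (B : 'M[R]_(n, m)) (E : 'M[R]_(n, d)) (W : set 'cV[R]_d)
    (Sxu : set 'cV[R]_(n + m)) (x : 'cV[R]_n) (u : nat -> 'cV[R]_m)
    (t : nat) : Prop :=
  forall p, Wbar A E W t p -> Sxu (col_mx (open_loop A B x u t + p) (u t)).

Definition lasso {T : Type} (tau lambda : nat) (u : nat -> T) : Prop :=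
  forall t, (tau <= t)%N -> u (t + lambda)%N = u t.

Section RobustSafety.
Variables (R : realType) (n m d : nat) (A : 'M[R]_n) (B : 'M[R]_(n, m)).
Variables (E : 'M[R]_(n, d)) (W : set 'cV[R]_d) (Sxu : set 'cV[R]_(n + m)).
Implicit Types (x y : 'cV[R]_n) (u : nat -> 'cV[R]_m).

Lemma open_loop_shift x u y t :
  open_loop A B (A *m x + B *m u 0%N + y) (fun s => u s.+1) t =
  open_loop A B x u t.+1 + A ^+ t *m y.
Proof.
have sumE : \sum_(1 <= i < t.+2) A ^+ i.-1 *m B *m u (t.+1 - i)%N =
    \sum_(1 <= i < t.+1) A ^+ i.-1 *m B *m u (t - i).+1
    + A ^+ t *m (B *m u 0%N).
  rewrite big_nat_recr //= subnn mulmxA; congr (_ + _).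
  by apply: eq_big_nat => i /andP[_ it]; rewrite subSn.
rewrite /open_loop sumE !mulmxDr exprSr -mulmxE -!mulmxA addrA.
by rewrite [LHS](ACl (1*4*2*3)).
Qed.

(** Seen from the successor state at time t, the disturbance w just received
    contributes A^t E w, which is an element of the last summand of
    Wbar (t + 1). *)
Lemma robustly_safe_shift x u (w : 'cV[R]_d) :
  W w -> (forall t, safe_at A B E W Sxu x u t) ->
  forall t, safe_at A B E W Sxu (A *m x + B *m u 0%N + E *m w)
                    (fun s => u s.+1) t.
Proof.
move=> Ww safe t p hp; rewrite open_loop_shift -addrA [X in _ + X]addrC.
apply: safe; rewrite WbarS; exists p => //; exists (A ^+ t *m (E *m w)) => //.
by exists w => //; rewrite mulmxA.
Qed.

Section Nilpotent.
Variable nu : nat.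
Hypotheses (nu_gt0 : (0 < nu)%N) (Anu : A ^+ nu = 0).

Lemma open_loop_nilpotent x u t :
  (nu <= t)%N ->
  open_loop A B x u t =
  \sum_(1 <= i < nu.+1) A ^+ i.-1 *m B *m u (t - i)%N.
Proof.
have A0 k : (nu <= k)%N -> A ^+ k = 0.
  by move=> /subnK <-; rewrite exprD Anu mulr0.
move=> nut; rewrite /open_loop A0 // mul0mx add0r.
rewrite (big_cat_nat (n := nu.+1)) //=.
rewrite [X in _ + X]big_nat_cond [X in _ + X]big1 ?addr0 //.
move=> i /andP[/andP[nui _] _].
by rewrite A0 ?mul0mx // -ltnS prednK // (leq_trans _ nui).
Qed.

(** From time nu on, the accumulated disturbance set is constant and the state
    only depends on the last nu inputs; these all have index at least tau, where
    advancing by lambda changes nothing. *)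
Lemma safe_at_lasso tau lambda x u t :
  lasso tau lambda u -> (nu + tau <= t)%N ->
  safe_at A B E W Sxu x u t -> safe_at A B E W Sxu x u (t + lambda).
Proof.
move=> lu nt safe p; have nut : (nu <= t)%N by lia.
have nutl : (nu <= t + lambda)%N by lia.
rewrite (Wbar_nilpotent _ _ _ _ _ _ _ _ nu_gt0 Anu nutl) lu; last by lia.
rewrite -(Wbar_nilpotent _ _ _ _ _ _ _ _ nu_gt0 Anu nut) => /safe.
rewrite !open_loop_nilpotent //.
rewrite (@eq_big_nat _ _ _ _ _ _
  (fun i => A ^+ i.-1 *m B *m u (t + lambda - i)%N)) // => i hi.
by rewrite addnC -addnBA 1?addnC ?lu //; lia.
Qed.

Lemma robustly_safe_lasso tau lambda x u :
  (0 < lambda)%N -> lasso tau lambda u ->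
  (forall t, (t < nu + tau + lambda)%N -> safe_at A B E W Sxu x u t) ->
  forall t, safe_at A B E W Sxu x u t.
Proof.
move=> l0 lu safe t; have [k] := ubnP t; elim: k t => // k IH t tk.
have [/safe //|le_t] := ltnP t (nu + tau + lambda).
rewrite -(@subnK lambda t); last by lia.
by apply: safe_at_lasso lu _ _; [lia|apply: IH; lia].
Qed.

End Nilpotent.
End RobustSafety.

(** * Input sequences generated by the lasso matrices *)

Definition lasso_input {R : realType} {m q : nat} (tau : nat)
    (v : 'cV[R]_(m * q)) (t : nat) : 'cV[R]_m :=
  lasso_H R m q *m lasso_P R m q tau ^+ t *m v.

Section LassoInput.
Variables (R : realType) (m q tau : nat).
Implicit Type v : 'cV[R]_(m * q).

Lemma blkdiag_exp (M : 'M[R]_q) t : blkdiag m M ^+ t = blkdiag m (M ^+ t).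
Proof.
rewrite /blkdiag; elim: t => [|t IH]; last first.
  by rewrite !exprS IH -!mulmxE tensmx_mul mul1mx.
apply/matrixP=> i j; case: (mxtens_indexP i) => a b.
case: (mxtens_indexP j) => a' b'.
rewrite !expr0 tensmxE !mxE (can_eq (@mxtens_indexK _ _)) xpair_eqE.
by rewrite -mulnb natrM.
Qed.

Lemma lasso_inputE v t k :
  lasso_input tau v t k 0 =
  \sum_j (lasso_Hbar R q *m lasso_Pbar R q tau ^+ t) 0 j
         * v (mxtens_index (k, j)) 0.
Proof.
have castM m1 m2 (e : m1 = m2) (X : 'M[R]_(m1, m * q)) (Y : 'M[R]_(m * q)) :
    castmx (e, erefl _) X *m Y = castmx (e, erefl _) (X *m Y).
  by case: m2 / e; rewrite !castmx_id.
rewrite /lasso_input /lasso_H /lasso_P blkdiag_exp castM tensmx_mul mul1mx mxE.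
have kE : cast_ord (esym (muln1 m)) k = mxtens_index (k, 0).
  by apply: val_inj; rewrite /= muln1 addn0.
rewrite (reindex (@mxtens_index m q)) /=; last first.
  exists (@mxtens_unindex m q) => i _; [exact: mxtens_indexK|].
  exact: mxtens_unindexK.
rewrite (eq_bigr (fun ij : 'I_m * 'I_q =>
  (1%:M *t (lasso_Hbar R q *m lasso_Pbar R q tau ^+ t)) (mxtens_index (k, 0))
    (mxtens_index (ij.1, ij.2)) * v (mxtens_index (ij.1, ij.2)) 0)); last first.
  by case=> i j _; rewrite castmxE cast_ord_id /= kE.
rewrite -(pair_bigA _ (fun i j => (1%:M *t _) _ (mxtens_index (i, j)) *
  v (mxtens_index (i, j)) 0)) /=.
(* The k-th row of a block diagonal matrix only meets the k-th block of v. *)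
rewrite (bigD1 k) //= [X in _ + X]big1 ?addr0 => [|i ik]; last first.
  by apply: big1 => j _; rewrite tensmxE mxE eq_sym (negbTE ik) !mul0r.
by apply: eq_bigr => j _; rewrite tensmxE mxE eqxx mul1r.
Qed.

Lemma delta_lasso_Pbar (i : 'I_q) (j : nat) :
  j = (if (i.+1 < q)%N then i.+1 else tau) ->
  forall jq : (j < q)%N,
  delta_mx 0 i *m lasso_Pbar R q tau = delta_mx 0 (Ordinal jq) :> 'rV_q.
Proof.
move=> -> jq; rewrite -rowE; apply/rowP => l.
by rewrite !mxE eqxx /= -val_eqE /=; case: ifP.
Qed.

(** Right multiplication by Pbar moves the selected entry one step forward,
    until the last of the q positions is reached; lasso_row_return then sends
    it back to position tau. *)
Lemma lasso_row (i : 'I_q) :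
  lasso_Hbar R q *m lasso_Pbar R q tau ^+ i = delta_mx 0 i.
Proof.
case: i => t; elim: t => [|t IH] tq.
  rewrite expr0 mulmx1; apply/rowP => j; rewrite !mxE eqxx.
  by rewrite -val_eqE.
have tq' : (t < q)%N by lia.
rewrite /= exprSr -mulmxE mulmxA (IH tq').
by apply: delta_lasso_Pbar; rewrite /= tq.
Qed.

Hypothesis tau_lt_q : (tau < q)%N.

Lemma lasso_row_return :
  lasso_Hbar R q *m lasso_Pbar R q tau ^+ q =
  lasso_Hbar R q *m lasso_Pbar R q tau ^+ tau.
Proof.
have q1q : (q.-1 < q)%N by lia.
have -> : lasso_Pbar R q tau ^+ q =
    lasso_Pbar R q tau ^+ q.-1 *m lasso_Pbar R q tau.
  by rewrite mulmxE -exprSr prednK //; lia.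
rewrite mulmxA (lasso_row (Ordinal q1q)).
rewrite (lasso_row (Ordinal tau_lt_q)).
by apply: delta_lasso_Pbar; rewrite /= prednK ?ltnn //; lia.
Qed.

Lemma lasso_input_lasso v : lasso tau (q - tau) (lasso_input tau v).
Proof.
move=> t tt; apply/matrixP => k j; rewrite ord1 !lasso_inputE.
have -> : (t + (q - tau) = q + (t - tau))%N by lia.
rewrite -[in RHS](subnKC tt) !exprD -!mulmxE !mulmxA.
by rewrite lasso_row_return.
Qed.

Lemma lasso_input_lt v (i : 'I_q) k :
  lasso_input tau v i k 0 = v (mxtens_index (k, i)) 0.
Proof.
rewrite lasso_inputE lasso_row (bigD1 i) //= big1 ?addr0 => [|j ji].
  by rewrite mxE !eqxx mul1r.
by rewrite mxE (negbTE ji) andbF mul0r.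
Qed.

(** A lasso is determined by its first q values, which v may list freely. *)
Lemma lasso_input_surj (u : nat -> 'cV[R]_m) :
  lasso tau (q - tau) u -> exists v, lasso_input tau v = u.
Proof.
move=> lu; pose v : 'cV[R]_(m * q) :=
  \col_j u (@mxtens_unindex m q j).2 (@mxtens_unindex m q j).1 0.
exists v; apply/funext => t; have [k] := ubnP t; elim: k t => // k IH t tk.
have [tq|qt] := ltnP t q.
  apply/matrixP => a b; rewrite ord1 (lasso_input_lt v (Ordinal tq)) mxE.
  by rewrite mxtens_indexK.
rewrite -(@subnK (q - tau) t); last by lia.
rewrite (@lasso_input_lasso v) ?lu; [|lia..].
by apply: IH; lia.
Qed.

End LassoInput.

(** * Safety characterization of the closed-form set *)

Section ClosedForm.
Variables (R : realType) (n m d : nat) (A : 'M[R]_n) (B : 'M[R]_(n, m)).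
Variables (E : 'M[R]_(n, d)) (W : set 'cV[R]_d) (Sxu : set 'cV[R]_(n + m)).
Variable nu : nat.
Hypotheses (nu_gt0 : (0 < nu)%N) (Anu : A ^+ nu = 0).

(** The two families of conditions merge into one: for t >= nu the terms
    A^t x and those with i > nu vanish, and Wbar t = Wbar nu. *)
Lemma Cxv_lassoE q tau lambda (z : 'cV[R]_(n + m * q)) :
  Cxv_lasso A B E W Sxu nu q tau lambda z <->
  forall t, (t < nu + tau + lambda)%N ->
    safe_at A B E W Sxu (usubmx z) (lasso_input tau (dsubmx z)) t.
Proof.
have sumE k t : \sum_(1 <= i < k) A ^+ i.-1 *m B *m lasso_H R m q
      *m lasso_P R m q tau ^+ (t - i) *m dsubmx z =
    \sum_(1 <= i < k) A ^+ i.-1 *m B *m lasso_input tau (dsubmx z) (t - i)%N.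
  by apply: eq_bigr => i _; rewrite /lasso_input !mulmxA.
split=> [[pre post] t tq|safe].
  have [tnu|nut] := ltnP t nu.
    have /pre/minkowski_diff_times_zero h : (t <= nu.-1)%N by lia.
    by move=> p /h; rewrite sumE.
  have /post/minkowski_diff_times_zero h :
    (nu <= t <= (nu + tau + lambda).-1)%N by lia.
  move=> p; rewrite (Wbar_nilpotent _ _ _ _ _ _ _ _ nu_gt0 Anu nut) => /h.
  by rewrite sumE (open_loop_nilpotent _ _ _ _ _ _ Anu).
split=> t ht; apply/minkowski_diff_times_zero => p; rewrite sumE.
  by apply: safe; lia.
have nut : (nu <= t)%N by lia.
rewrite /Wbar_infty -(Wbar_nilpotent _ _ _ _ _ _ _ _ nu_gt0 Anu nut).
rewrite -(open_loop_nilpotent _ _ _ _ _ _ Anu (usubmx z)) //.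
by apply: safe; lia.
Qed.

Lemma proj_Cxv_lassoE q tau lambda (x : 'cV[R]_n) :
  Theta q (tau, lambda) ->
  proj_fst (Cxv_lasso A B E W Sxu nu q tau lambda) x <->
  exists2 u, lasso tau lambda u & forall t, safe_at A B E W Sxu x u t.
Proof.
case=> /= l0 tlq; have tq : (tau < q)%N by lia.
have lE : lambda = (q - tau)%N by lia.
split=> [[z /Cxv_lassoE safe <-]|[u lu safe]].
  have lu := @lasso_input_lasso R m q tau tq (dsubmx z); rewrite -lE in lu.
  by exists (lasso_input tau (dsubmx z)) => //; apply: robustly_safe_lasso safe.
have [|v uE] := @lasso_input_surj R m q tau tq u; first by rewrite -lE.
exists (col_mx x v); last by rewrite col_mxKu.
by apply/Cxv_lassoE => t _; rewrite col_mxKu col_mxKd uE.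
Qed.

Lemma CxE q :
  Cx A B E W Sxu nu q =
  \bigcup_(tl in Theta q) proj_fst (Cxv_lasso A B E W Sxu nu q tl.1 tl.2).
Proof. exact: image_bigcup. Qed.

Lemma Cx_safeP q (x : 'cV[R]_n) :
  Cx A B E W Sxu nu q x <->
  exists tau lambda, Theta q (tau, lambda) /\
  exists2 u, lasso tau lambda u & forall t, safe_at A B E W Sxu x u t.
Proof.
rewrite CxE; split=> [[[tau lambda] th /proj_Cxv_lassoE/= hx]|].
  by exists tau, lambda; split=> //; apply: hx.
by move=> [tau [lambda [th /proj_Cxv_lassoE hx]]]; exists (tau, lambda) => //;
  apply: hx.
Qed.

Lemma Cx_RCIS q : RCIS A B E W Sxu (Cx A B E W Sxu nu q).
Proof.
have safe0 x u : (forall t, safe_at A B E W Sxu x u t) ->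
    Sxu (col_mx x (u 0%N)).
  move=> /(_ 0%N 0); rewrite /open_loop big_geq // expr0 mul1mx !addr0; apply.
  by rewrite /Wbar big_geq.
split=> [x /Cx_safeP [tau [lambda [th [u lu safe]]]]|].
  by exists (col_mx x (u 0%N)); [exact: safe0|rewrite col_mxKu].
move=> x /Cx_safeP [tau [lambda [th [u lu safe]]]].
exists (u 0%N); split; first exact: safe0.
move=> _ [_ -> [_ [w Ww <-] <-]]; apply/Cx_safeP; exists tau, lambda.
split=> //; exists (fun t => u t.+1); last exact: robustly_safe_shift.
by move=> t tt; rewrite -addSn lu // leqW.
Qed.

Lemma Cx_subset q q' :
  (q' <= q)%N -> Cx A B E W Sxu nu q' `<=` Cx A B E W Sxu nu q.
Proof.
move=> qq x /Cx_safeP [tau [lambda [[/= l0 tl] [u lu safe]]]]; apply/Cx_safeP.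
exists (tau + (q - q'))%N, lambda; split; first by split=> //=; lia.
by exists u => // t tt; apply: lu; lia.
Qed.

End ClosedForm.

Theorem theorem4p1 (R : realType) (n m d : nat) (A : 'M[R]_n)
    (B : 'M[R]_(n, m)) (E : 'M[R]_(n, d)) (Sxu : set 'cV[R]_(n + m))
    (W : set 'cV[R]_d) (nu : nat)
    (hA : nilpotency_index A nu) (hS : polytope Sxu) (hW : polytope W) :
  (forall q : nat, (0 < q)%N ->
     [/\ implicit_RCIS A B E W Sxu (Cxv A B E W Sxu nu q),
         Cx A B E W Sxu nu q =
           \bigcup_(tl in Theta q)
             proj_fst (Cxv_lasso A B E W Sxu nu q tl.1 tl.2) &
         RCIS A B E W Sxu (Cx A B E W Sxu nu q)]) /\
  (forall q q' : nat, (0 < q')%N -> (q' < q)%N ->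
     Cx A B E W Sxu nu q' `<=` Cx A B E W Sxu nu q).
Proof.
case: hA => nu0 Anu _; split=> [q _|q q' _ qq]; last first.
  by apply: Cx_subset => //; apply: ltnW.
by split; [exact: Cx_RCIS|exact: CxE|exact: Cx_RCIS].
Qed.
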